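(* Let $\{X_n\}_{n\in\mathbb Z}$ be a stationary and ergodic finitarily Markovian process with values in a finite or countably infinite alphabet $\mathcal X$, and let $0<\gamma<1$. Let $\mathcal N$ be a sequence of stopping times (a random set of times such that for each $n$ the event $n\in\mathcal N$ depends only on $X_0^n$) such that, almost surely, for all sufficiently large $n\in\mathcal N$ the string $X_{n-K(X_{-\infty}^n)+1}^n$ appears at least $n^{1-\gamma}$ times in $X_0^n$. Let $\rho_n$ be any estimate of the length of the memory computed from $X_0^n$ such that, almost surely, $\rho_n-K(X_{-\infty}^n)\to0$ along $n\in\mathcal N$. For $x\in\mathcal X$ and $n\in\mathcal N$ define $$\hat q_n(x)=\frac{\#\{\rho_n-1\le i<n: X_{i-\rho_n+1}^i=X_{n-\rho_n+1}^n,\ X_{i+1}=x\}}{\#\{\rho_n-1\le i<n: X_{i-\rho_n+1}^i=X_{n-\rho_n+1}^n\}}.$$ Then for each $x\in\mathcal X$, along $n\in\mathcal N$, $$\left|\hat q_n(x)-P(X_{n+1}=x\mid X_0^n)\right|\to0\quad\text{almost surely.}$$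
   Context: Notation: $X_m^n=(X_m,\dots,X_n)$ for $m\le n$, and $X_m^n$ is the empty string if $m>n$. $p(x_{-k}^0)=P(X_{-k}^0=x_{-k}^0)$ and $p(y|x_{-k}^0)=P(X_1=y\mid X_{-k}^0=x_{-k}^0)$; for the empty string $\emptyset$, $p(\emptyset)=1$ and $p(y|\emptyset)=P(X_1=y)$. Memory length: $K(X_{-\infty}^0)$ is the smallest $0\le K<\infty$ such that for all $i\ge1$, $y\in\mathcal X$, $z_{-K-i+1}^{-K}\in\mathcal X^i$ one has $p(y|X_{-K+1}^0)=p(y|z_{-K-i+1}^{-K},X_{-K+1}^0)$ provided $p(z_{-K-i+1}^{-K},X_{-K+1}^0,y)>0$; $K(X_{-\infty}^0)=\infty$ if there is no such $K$. $K(X_{-\infty}^n)$ is the same function applied to the past of time $n$ (i.e. to the shifted sequence). The process is finitarily Markovian if $K(X_{-\infty}^0)<\infty$ almost surely. *)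

(* Defs.v *)
(* A process is a family
   [X : int -> T -> A] on a probability space [(T, P)], and strings over the
   alphabet [A] are sequences listed from the oldest letter to the newest. *)
From HB Require Import structures.
From mathcomp Require Import all_boot all_order all_algebra.
From mathcomp Require Import all_classical all_reals all_analysis.

Set Implicit Arguments.
Unset Strict Implicit.
Unset Printing Implicit Defensive.

Import Order.TTheory GRing.Theory Num.Theory.
Import numFieldNormedType.Exports.

Local Open Scope classical_set_scope.
Local Open Scope ring_scope.

Definition trajectory (T A : Type) (X : int -> T -> A) (t : T) : int -> A :=
  fun i => X i t.

Definition shift_seq (A : Type) (n : int) (x : int -> A) : int -> A :=
  fun i => x (i + n).

(* x_m^n = (x_m, ..., x_n), empty when n < m *)
Definition str (A : Type) (x : int -> A) (m n : int) : seq A :=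
  if (m <= n)%R then mkseq (fun i => x (m + i%:Z)) `|n - m|%N.+1 else [::].

(* The alphabet carries the discrete sigma-algebra. *)
Definition is_process d (T : measurableType d) (A : countType)
    (X : int -> T -> A) : Prop :=
  forall (n : int) (B : set A), measurable (X n @^-1` B).

Definition stationary d (T : measurableType d) (R : realType)
    (P : probability T R) (A : countType) (X : int -> T -> A) : Prop :=
  forall (m : int) (k : nat) (w : seq A),
    P [set t | str (trajectory X t) m (m + k%:Z) = w] =
    P [set t | str (trajectory X t) 0 k%:Z = w].

Definition path_events (A : countType) : set (set (int -> A)) :=
  <<s [set B | exists (i : int) (a : A), B = [set x | x i = a]] >>.

Definition ergodic d (T : measurableType d) (R : realType)
    (P : probability T R) (A : countType) (X : int -> T -> A) : Prop :=
  forall B : set (int -> A), path_events B -> shift_seq 1 @^-1` B = B ->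
    P (trajectory X @^-1` B) = 0%E \/ P (trajectory X @^-1` B) = 1%E.

Definition cond_prob d (T : measurableType d) (R : realType)
    (P : probability T R) (E F : set T) : R :=
  fine (P (E `&` F)) / fine (P F).

(* p(w) = P(X_{-k+1}^0 = w), where k is the length of w *)
Definition word_prob d (T : measurableType d) (R : realType)
    (P : probability T R) (A : countType) (X : int -> T -> A)
    (w : seq A) : R :=
  fine (P [set t | str (trajectory X t) (1 - (size w)%:Z) 0 = w]).

(* p(y | w) = P(X_1 = y | X_{-k+1}^0 = w), where k is the length of w *)
Definition next_prob d (T : measurableType d) (R : realType)
    (P : probability T R) (A : countType) (X : int -> T -> A)
    (y : A) (w : seq A) : R :=
  cond_prob P [set t | X 1 t = y]
    [set t | str (trajectory X t) (1 - (size w)%:Z) 0 = w].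

Definition memory_word d (T : measurableType d) (R : realType)
    (P : probability T R) (A : countType) (X : int -> T -> A)
    (w : seq A) : Prop :=
  forall (z : seq A) (y : A), (1 <= size z)%N ->
    0 < word_prob P X (z ++ w ++ [:: y]) ->
    next_prob P X y w = next_prob P X y (z ++ w).

(* K(x_{-oo}^0), with None standing for the value +oo *)
Definition memory_length d (T : measurableType d) (R : realType)
    (P : probability T R) (A : countType) (X : int -> T -> A)
    (x : int -> A) : option nat :=
  if pselect (exists k : nat, `[< memory_word P X (str x (1 - k%:Z) 0) >])
    is left ex_k then Some (ex_minn ex_k) else None.

(* K(X_{-oo}^n) as a random variable *)
Definition memory d (T : measurableType d) (R : realType)
    (P : probability T R) (A : countType) (X : int -> T -> A)
    (n : nat) (t : T) : option nat :=
  memory_length P X (shift_seq n%:Z (trajectory X t)).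

Definition length_to_ereal (R : realType) (k : option nat) : \bar R :=
  if k is Some k' then (k'%:R)%:E else +oo%E.

Definition finitarily_markovian d (T : measurableType d) (R : realType)
    (P : probability T R) (A : countType) (X : int -> T -> A) : Prop :=
  {ae P, forall t, exists k : nat,
    memory_length P X (trajectory X t) = Some k}.

(* f is a function of X_0^n. As A is countable and discrete, every such f
   is automatically sigma(X_0^n)-measurable. *)
Definition function_of_past (T A C : Type) (X : int -> T -> A) (n : nat)
    (f : T -> C) : Prop :=
  exists g : seq A -> C, forall t, f t = g (str (trajectory X t) 0 n%:Z).

(* number of positions at which w appears in u, overlaps included *)
Definition occurrences (A : countType) (w u : seq A) : nat :=
  count (fun s => prefix w (drop s u)) (iota 0 (size u).+1).

(* The counts run over j = i + 1, which is a natural number even when r = 0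
   and i starts from -1. The quotient is 0 if the denominator vanishes. *)
Definition qhat (R : realType) (A : countType) (x : int -> A)
    (n r : nat) (a : A) : R :=
  let matches (j : nat) := str x (j%:Z - r%:Z) (j%:Z - 1)
                           == str x (n%:Z - r%:Z + 1) n%:Z in
  (\sum_(r <= j < n.+1) (matches j && (x j%:Z == a)))%N%:R /
  (\sum_(r <= j < n.+1) matches j)%N%:R.

(* P(X_{n+1} = a | X_0^n) as a random variable *)
Definition next_given_past d (T : measurableType d) (R : realType)
    (P : probability T R) (A : countType) (X : int -> T -> A)
    (n : nat) (a : A) (t : T) : R :=
  cond_prob P [set u | X n.+1%:Z u = a]
    [set u | str (trajectory X u) 0 n%:Z = str (trajectory X t) 0 n%:Z].

(* Main.v *)
Require Import Defs.
From HB Require Import structures.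
From mathcomp Require Import all_boot all_order all_algebra.
From mathcomp Require Import all_classical all_reals all_analysis.
From mathcomp Require Import zify ring lra.

(** Let w be the suffix of X_0^n whose length is the memory length at time n.
    By the definition of the memory length, w is a memory word: after any past
    that ends in w and has positive probability, the next letter is x with
    probability p = P(X_1 = x | w). So P(X_{n+1} = x | X_0^n) = p almost surely.
    Moreover, along the stopping times, rho_n is eventually the length of w, because both are integers, and
    then the estimate is the frequency of x among the letters that follow the
    visits to w before time n. It remains to show that this frequency is close
    to p as soon as w has been visited n^(1 - gamma) times. The word w is random
    and the alphabet may be infinite, so one needs a bound uniform over all
    memory words that X_0^n has exhibited.

    The bound comes from a gambler who waits until some memory word w has been
    seen, and from then on, after each visit to w, buys tickets for the next
    letter, lam of them per unit of the current capital: a ticket costs p and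
    pays 1 if the letter is x, which is fair. The capital is a nonnegative martingale that starts
    from 1, so it reaches c with probability at most 1/c ([ville]). This holds
    conditionally on the past at the time j when the bets start, hence it holds
    for the random word w that consists of the last k letters before j
    ([winning_bet_prob]), and the union over w costs nothing. There are
    about n^2 pairs (j, k) up to time n, so with c of order n^4 the
    Borel-Cantelli lemma shows that almost surely, for large n, no bet has
    reached c ([eventually_no_winning_bet]).

    If D visits to w have been followed by C letters x, then the capital is at
    least exp(lam (C - p D) - 2 lam^2 D) ([capital_ge]). Using the bets lam and
    - lam, from the first visit to w on, one gets
    |C / D - p| <= 2 lam + ln c / (lam D). As ln c grows like ln n and D like a
    positive power of n, the limit superior of the error is at most 2 lam, and
    lam is arbitrary. *)

Set Implicit Arguments.
Unset Strict Implicit.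
Unset Printing Implicit Defensive.

Import Order.TTheory GRing.Theory Num.Theory.
Import numFieldNormedType.Exports.

Local Open Scope classical_set_scope.
Local Open Scope ring_scope.

(** * Comparing events along a countable partition *)
Section Domination.
Context d (T : measurableType d) (R : realType) (P : probability T R).

Lemma fine_probK (E : set T) : measurable E -> ((fine (P E))%:E = P E)%E.
Proof. by move=> mE; rewrite fineK ?fin_num_measure. Qed.

Lemma le_fine_prob (E F : set T) : measurable E -> measurable F -> E `<=` F ->
  fine (P E) <= fine (P F).
Proof.
move=> mE mF EF; rewrite -lee_fin !fine_probK //.
by apply: le_measure; rewrite ?inE.
Qed.

Lemma fine_prob_split (E F : set T) : measurable E -> measurable F ->
  fine (P E) = fine (P (E `&` F)) + fine (P (E `\` F)).
Proof.
move=> mE mF; have mI := measurableI _ _ mE mF; have mD := measurableD mE mF.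
rewrite -fineD ?fin_num_measure // -measureU ?setUIDK //.
by rewrite setIDA setDE -!setIA [F `&` _]setICA setICr !setI0.
Qed.

(** Inequalities between probabilities can be checked on the atoms of a
    countable partition. With it, conditioning on the past amounts to a case
    analysis on the word that has been read, and no conditional expectation is
    needed. *)
Lemma countable_domination (C : countType) (f : T -> C) (E F : set T) (s : R) :
  0 <= s -> (forall c, measurable (f @^-1` [set c])) ->
  measurable E -> measurable F ->
  (forall c, fine (P (E `&` f @^-1` [set c])) <=
             s * fine (P (F `&` f @^-1` [set c]))) ->
  fine (P E) <= s * fine (P F).
Proof.
move=> s0 mf mE mF le_c.
pose B n := [set t | pickle (f t) = n].
have BE n : B n = set0 \/ exists c, B n = f @^-1` [set c].
  have [[t tn]|no_t] := pselect (exists t, pickle (f t) = n); [right|left].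
    exists (f t); apply/seteqP; split=> u /=; rewrite /B /= -tn; last by move=> ->.
    exact: (pcan_inj (@pickleK _)).
  by apply/seteqP; split=> // t /= tn; apply: no_t; exists t.
have mB n : measurable (B n) by case: (BE n) => [E0|[c E0]]; rewrite E0.
have PE G : measurable G -> P G = (\sum_(n <oo) P (G `&` B n))%E.
  move=> mG; rewrite -measure_semi_bigcup //; first last.
  - by apply: bigcupT_measurable => n; exact: measurableI.
  - apply/trivIsetP => i j _ _ /eqP ij; apply/seteqP; split=> // t.
    by rewrite /B /= => -[[_ ti] [_ tj]]; apply: ij; rewrite -ti -tj.
  - by move=> n; exact: measurableI.
  congr (P _); apply/seteqP; split=> [t Gt|t [n _ []] //].
  by exists (pickle (f t)).
rewrite -lee_fin EFinM !fine_probK // (PE E) // (PE F) // -nneseriesZl //.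
apply: lee_nneseries => // n _.
have [E0 | [c E0]] := BE n; rewrite {}E0; first by rewrite !setI0 measure0 mule0.
have mI G : measurable G -> measurable (G `&` f @^-1` [set c]).
  by move=> mG; exact: measurableI.
by rewrite -(fine_probK (mI _ mE)) -(fine_probK (mI _ mF)) -EFinM lee_fin.
Qed.

Lemma fine_prob_bigcup_le (F : nat -> set T) (n : nat) (c : R) :
  (forall i, (i < n)%N -> measurable (F i)) ->
  (forall i, (i < n)%N -> fine (P (F i)) <= c) ->
  fine (P (\bigcup_(i in `I_n) F i)) <= n%:R * c.
Proof.
move=> mF leF; rewrite -lee_fin fine_probK; last exact: bigcup_measurable.
rewrite bigcup_mkord; apply: le_trans (Boole_inequality P mF) _.
apply: (@le_trans _ _ (\sum_(i < n) c%:E)%E).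
  apply: lee_sum => i _; rewrite -[leLHS]/(P (F i)).
  by rewrite -(fine_probK (mF _ (ltn_ord i))) lee_fin leF.
by rewrite sumEFin sumr_const card_ord mulr_natl.
Qed.

(** The bound 1/((n+1)(n+2)) is chosen because its sum telescopes. *)
Lemma borel_cantelli (E : nat -> set T) : (forall n, measurable (E n)) ->
  (forall n, fine (P (E n)) <= (n.+1%:R * n.+2%:R)^-1) ->
  {ae P, forall t, \forall n \near \oo, ~ E n t}.
Proof.
move=> mE leE; exists (lim_sup_set E); split.
- apply: bigcapT_measurable => n; apply: bigcup_measurable => k _; exact: mE.
- apply: lim_sup_set_cvg0 => //.
  apply: (@le_lt_trans _ _ 1%E); last by rewrite ltry.
  apply: lime_le; first exact: is_cvg_nneseries.
  apply: nearW => n.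
  apply: (@le_trans _ _ (\sum_(0 <= i < n) (- i.+2%:R^-1 - - i.+1%:R^-1)%:E)%E).
    apply: lee_sum => i _; rewrite -[leLHS]/(P (E i)) -fine_probK // lee_fin.
    apply: (le_trans (leE i)).
    rewrite le_eqVlt; apply/orP; left; apply/eqP.
    have := ltr0Sn R i; have := ltr0Sn R i.+1; rewrite -[i.+2%:R]natr1.
    by move: (i.+1%:R : R) => a a1 a0; field; rewrite !gt_eqF.
  rewrite sumEFin lee_fin (telescope_sumr (fun i => - i.+1%:R^-1)) //.
  by rewrite invr1 opprK gerDr oppr_le0 invr_ge0.
- move=> t /= nev n _ /=; apply: contrapT => no; apply: nev.
  by exists n => // k nk Ek; apply: no; exists k.
Qed.
End Domination.

(** * Words read along a stationary process *)

(** The letters y_0, ..., y_{n-1}: indexing by the length makes the empty past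
    available and turns a new letter into [rcons]. *)
Definition history (A : Type) (y : int -> A) (n : nat) : seq A :=
  mkseq (fun i => y i%:Z) n.

Section Words.
Variable A : Type.
Implicit Types (y : int -> A) (m : int) (k n : nat).

Lemma str_mkseq y m k :
  str y m (m + k%:Z - 1) = mkseq (fun i => y (m + i%:Z)) k.
Proof.
rewrite /str; case: k => [|k]; first by rewrite addr0 lerDl.
have -> : m + k.+1%:Z - 1 = m + k%:Z by rewrite -addn1 PoszD addrA addrK.
by rewrite lerDl /= addrC addrA addNr add0r absz_nat.
Qed.

Lemma last_word_mkseq y n k :
  str y (n%:Z - k%:Z + 1) n%:Z = mkseq (fun i => y (n%:Z - k%:Z + 1 + i%:Z)) k.
Proof. by rewrite -str_mkseq; congr (str y _ _); ring. Qed.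

Lemma size_history y n : size (history y n) = n.
Proof. exact: size_mkseq. Qed.

Lemma historyS y n : history y n.+1 = rcons (history y n) (y n%:Z).
Proof. exact: mkseqS. Qed.

Lemma str_history y n : str y 0 n%:Z = history y n.+1.
Proof.
have := str_mkseq y 0 n.+1; rewrite add0r -(addn1 n) PoszD addrK => ->.
rewrite addn1.
by apply: eq_mkseq => i; rewrite add0r.
Qed.

Lemma drop_history y n k : (k <= n)%N ->
  str y (n%:Z - k%:Z) (n%:Z - 1) = drop (n - k) (history y n).
Proof.
move=> kn; have := str_mkseq y (n%:Z - k%:Z) k; rewrite subrK => ->.
case: k kn => [|k] kn; first by rewrite drop_oversize ?size_history ?subn0.
apply: (@eq_from_nth _ (y 0)) => [|i].
  by rewrite size_drop size_history size_mkseq subKn.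
rewrite size_mkseq => ik; rewrite nth_drop !nth_mkseq //; last first.
  by rewrite -ltn_subRL subKn.
by congr (y _); rewrite PoszD subzn.
Qed.

Lemma take_history y n k : (k <= n)%N -> take k (history y n) = history y k.
Proof. by move=> kn; rewrite /history /mkseq -map_take take_iota (minn_idPl kn). Qed.

End Words.

Section Process.
Context d (T : measurableType d) (R : realType) (P : probability T R).
Context (A : countType) (X : int -> T -> A).
Hypotheses (Xproc : is_process X) (Xstat : stationary P X).
Implicit Types (t : T) (u w z : seq A) (a y : A).

Local Notation hist n t := (history (trajectory X t) n).

Lemma measurable_window (m : int) (k : nat) (B : set (seq A)) :
  measurable [set t | B (mkseq (fun i => X (m + i%:Z) t) k)].
Proof.
elim: k B => [|k IHk] B.
  have [B0|B0] := pselect (B [::]).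
    by rewrite (_ : [set _ | _] = setT) //; apply/seteqP; split.
  by rewrite (_ : [set _ | _] = set0) //; apply/seteqP; split.
rewrite (_ : [set _ | _] = \bigcup_a (X (m + k%:Z) @^-1` [set a] `&`
    [set t | [set u | B (rcons u a)] (mkseq (fun i => X (m + i%:Z) t) k)])).
  apply: countable_bigcupT_measurable => [|a]; first exact: countableP.
  by apply: measurableI; [exact: Xproc|exact: IHk].
apply/seteqP; split=> t /=; rewrite mkseqS.
  by exists (X (m + k%:Z) t).
by case=> a _ [/= -> ].
Qed.

(** Since the alphabet is countable, any event that is decided by finitely many
    letters is measurable. *)
Lemma measurable_past (n : nat) (E : set T) :
  (forall t t', hist n t = hist n t' -> E t -> E t') -> measurable E.
Proof.
move=> En; pose B := [set u | exists2 t, E t & hist n t = u].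
rewrite (_ : E = [set t | B (mkseq (fun i => X (0 + i%:Z) t) n)]).
  exact: measurable_window.
have h t : mkseq (fun i => X (0 + i%:Z) t) n = hist n t.
  by apply: eq_mkseq => i; rewrite add0r.
apply/seteqP; split=> t /=; rewrite h; first by exists t.
by case=> t' Et' /En; apply.
Qed.

Definition cylinder_prob w : R := fine (P [set t | hist (size w) t = w]).

Lemma cylinder_rcons w y :
  [set t | hist (size (rcons w y)) t = rcons w y] =
  [set t | hist (size w) t = w] `&` X (size w)%:Z @^-1` [set y].
Proof.
apply/seteqP; split=> t /=; rewrite size_rcons historyS.
  by move/rcons_inj => -[].
by case=> -> <-.
Qed.

Lemma measurable_cylinder w : measurable [set t | hist (size w) t = w].
Proof. by apply: (@measurable_past (size w)) => t t' /= ->. Qed.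

Lemma cylinder_prob_ge0 w : 0 <= cylinder_prob w.
Proof. exact: fine_ge0. Qed.

Lemma cylinder_prob_rcons_le w y : cylinder_prob (rcons w y) <= cylinder_prob w.
Proof.
rewrite /cylinder_prob cylinder_rcons; apply: le_fine_prob.
- by rewrite -cylinder_rcons; exact: measurable_cylinder.
- exact: measurable_cylinder.
- exact: subIsetl.
Qed.

(** Stationarity: the place where a word is read does not matter, and all
    probabilities can be expressed by words read from time 0 on. *)
Lemma window_prob (m : int) w :
  fine (P [set t | str (trajectory X t) m (m + (size w)%:Z - 1) = w]) =
  cylinder_prob w.
Proof.
congr fine; case: w => [|a w].
  congr (P _); apply/seteqP; split=> t /=; by rewrite ?str_mkseq.
have -> : m + (size (a :: w))%:Z - 1 = m + (size w)%:Z.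
  by rewrite /= -addn1 PoszD addrA addrK.
rewrite Xstat; congr (P _); apply/seteqP.
by split=> t /=; rewrite str_history.
Qed.

Lemma window_next_prob (m : int) w y :
  fine (P ([set t | X (m + (size w)%:Z) t = y] `&`
           [set t | str (trajectory X t) m (m + (size w)%:Z - 1) = w])) =
  cylinder_prob (rcons w y).
Proof.
rewrite -(window_prob m) size_rcons; congr (fine (P _)).
apply/seteqP; split=> t /=; rewrite !str_mkseq mkseqS.
  by case=> <- ->.
by move/rcons_inj => -[-> <-].
Qed.

Lemma word_probE w : word_prob P X w = cylinder_prob w.
Proof. by rewrite -(window_prob (1 - (size w)%:Z)) subrK subrr. Qed.

Lemma next_probE y w :
  next_prob P X y w = cylinder_prob (rcons w y) / cylinder_prob w.
Proof.
by rewrite /next_prob /cond_prob -(window_next_prob (1 - (size w)%:Z))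
  -(window_prob (1 - (size w)%:Z)) !subrK !subrr.
Qed.

Lemma next_given_pastE n y t :
  next_given_past P X n y t = next_prob P X y (hist n.+1 t).
Proof.
rewrite next_probE /next_given_past /cond_prob /cylinder_prob cylinder_rcons.
rewrite size_history setIC str_history.
by under eq_set do rewrite str_history.
Qed.

Lemma next_prob_ge0 y w : 0 <= next_prob P X y w.
Proof. by rewrite next_probE divr_ge0 // cylinder_prob_ge0. Qed.

Lemma next_prob_le1 y w : next_prob P X y w <= 1.
Proof.
rewrite next_probE; have [->|w0] := eqVneq (cylinder_prob w) 0.
  by rewrite invr0 mulr0 ler01.
have w_gt0 : 0 < cylinder_prob w by rewrite lt_def w0 cylinder_prob_ge0.
by rewrite ler_pdivrMr // mul1r cylinder_prob_rcons_le.
Qed.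

(** The definition of a memory word only compares the two conditional
    probabilities for letters y that can follow z w. For those letters the law
    given w agrees with the law given z w, which has total mass one on them; so
    the law given w has no mass left for the other letters, where both
    probabilities vanish. *)
Lemma memory_word_extend w z y : memory_word P X w ->
  0 < cylinder_prob (z ++ w) ->
  next_prob P X y w = next_prob P X y (z ++ w).
Proof.
case: z => [//|b z] mw; set v := (b :: z) ++ w => v_gt0.
have [vy0|vy_gt0] := eqVneq (cylinder_prob (rcons v y)) 0; last first.
  apply: mw => //; rewrite word_probE catA cats1.
  by rewrite lt_def vy_gt0 cylinder_prob_ge0.
pose W u := [set t | str (trajectory X t) (1 - (size u)%:Z) 0 = u].
have WE u : fine (P (W u)) = cylinder_prob u by rewrite -word_probE.
have WX u a : fine (P (W u `&` X 1 @^-1` [set a])) = cylinder_prob (rcons u a).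
  by rewrite -(window_next_prob (1 - (size u)%:Z)) subrK subrr setIC.
have mW u : measurable (W u).
  rewrite /W; have := measurable_window (1 - (size u)%:Z) (size u) [set u].
  congr measurable; apply/seteqP; split=> t /=;
    by rewrite -(str_mkseq (trajectory X t)) subrK subrr.
have mX a : measurable (X 1 @^-1` [set a]) by exact: Xproc.
have vw : cylinder_prob v <= cylinder_prob w.
  rewrite -!WE; apply: le_fine_prob => // t.
  have s u : str (trajectory X t) (1 - (size u)%:Z) 0 =
      mkseq (fun i => X (1 - (size u)%:Z + i%:Z) t) (size u).
    by rewrite -(str_mkseq (trajectory X t)) subrK subrr.
  move=> vt; suff: str (trajectory X t) (1 - (size w)%:Z) 0 = w by [].
  have : str (trajectory X t) (1 - (size v)%:Z) 0 = v := vt.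
  rewrite s => /(congr1 (drop (size (b :: z)))).
  rewrite [RHS]drop_size_cat // => {}vt.
  rewrite -[RHS]vt s /mkseq -map_drop drop_iota size_cat addKn add0n.
  have -> : iota (size (b :: z)) (size w) =
      map (addn (size (b :: z))) (iota 0 (size w)) by rewrite -iotaDl addn0.
  rewrite -map_comp.
  by apply: eq_map => i /=; congr (X _ t); rewrite !PoszD; ring.
have w_gt0 := lt_le_trans v_gt0 vw.
have diffE u : fine (P (W u `\` X 1 @^-1` [set y])) =
    cylinder_prob u - cylinder_prob (rcons u y).
  by rewrite -(WE u) (fine_prob_split _ (mW u) (mX y)) WX addrAC subrr add0r.
(* Up to normalisation, the law of the next letter given v is dominated by
   the law given w. *)
have le_a a : cylinder_prob (rcons v a) <=
    cylinder_prob v / cylinder_prob w * cylinder_prob (rcons w a).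
  have [->|va0] := eqVneq (cylinder_prob (rcons v a)) 0.
    by rewrite mulr_ge0 ?divr_ge0 ?cylinder_prob_ge0.
  have va_gt0 : 0 < word_prob P X ((b :: z) ++ w ++ [:: a]).
    by rewrite word_probE catA cats1 lt_def va0 cylinder_prob_ge0.
  have := mw (b :: z) a isT va_gt0; rewrite !next_probE -/v => e.
  by rewrite mulrAC -mulrA e mulrC divfK // gt_eqF.
have : fine (P (W v `\` X 1 @^-1` [set y])) <=
    cylinder_prob v / cylinder_prob w * fine (P (W w `\` X 1 @^-1` [set y])).
  apply: (countable_domination (f := X 1)) => // [|||a].
  - by rewrite divr_ge0 ?cylinder_prob_ge0.
  - exact: measurableD.
  - exact: measurableD.
  have [->|ay] := eqVneq a y.
    by rewrite !setDE -!setIA setICl !setI0 measure0 mulr0.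
  have DX u : (W u `\` X 1 @^-1` [set y]) `&` X 1 @^-1` [set a] =
      W u `&` X 1 @^-1` [set a].
    apply/seteqP; split=> t /= [Wt Xt]; split=> //; first by case: Wt.
    by split=> // Xy; move/eqP: ay; apply; rewrite -Xt.
  by rewrite !DX !WX.
(* All the mass after v lies outside y, which forces the mass after w to do
   the same. *)
rewrite !diffE vy0 subr0 mulrBr divfK ?gt_eqF // lerDl oppr_ge0 => le0.
have wy0 : cylinder_prob (rcons w y) = 0.
  apply/eqP; rewrite eq_le cylinder_prob_ge0 andbT.
  by move: le0; rewrite pmulr_rle0 // divr_gt0.
by rewrite !next_probE vy0 wy0 !mul0r.
Qed.

End Process.

(** * The gambler's capital *)

(** The capital at time n of a gambler who owns 1 at time j and who, at each
    visit to w, buys lam tickets per unit of capital, each of which costs p and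
    pays 1 if the next letter is x. A negative lam, that is, selling tickets,
    bets against x. *)
Definition capital (R : realType) (A : countType) (lam p : R) (w : seq A)
    (x : A) (y : int -> A) (j n : nat) : R :=
  \prod_(j <= i < n)
    (1 + lam * (suffix w (history y i))%:R * ((y i%:Z == x)%:R - p)).

Section Gambling.
Context d (T : measurableType d) (R : realType) (P : probability T R).
Context (A : countType) (X : int -> T -> A).
Hypotheses (Xproc : is_process X) (Xstat : stationary P X).
Variable x : A.
Implicit Types (t : T) (u w : seq A) (a : A) (lam c : R).

Local Notation hist n t := (history (trajectory X t) n).
Local Notation bet lam w := (capital lam (next_prob P X x w) w x).
Local Notation cyl := (cylinder_prob P X).

(** The one-step law after a visit to a memory word: this is what makes the
    bets fair. *)
Lemma cylinder_prob_rcons_memory u w : memory_word P X w -> suffix w u ->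
  cyl (rcons u x) = next_prob P X x w * cyl u.
Proof.
move=> mw /suffixP[z ->]; have [zw0|zw_neq0] := eqVneq (cyl (z ++ w)) 0.
  apply/eqP; rewrite zw0 mulr0 eq_le cylinder_prob_ge0 andbT -zw0.
  exact: cylinder_prob_rcons_le.
have zw_gt0 : 0 < cyl (z ++ w) by rewrite lt_def zw_neq0 cylinder_prob_ge0.
by rewrite (memory_word_extend Xproc Xstat x mw zw_gt0) (next_probE Xstat) divfK.
Qed.

Lemma eq_capital lam p w (y y' : int -> A) j n : history y n = history y' n ->
  capital lam p w x y j n = capital lam p w x y' j n.
Proof.
move=> yy'; apply: eq_big_nat => i /andP[_ lt_in].
have yi : y i%:Z = y' i%:Z.
  have := congr1 (fun u => nth x u i) yy'.
  by rewrite /history !nth_mkseq.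
by rewrite -(take_history y (ltnW lt_in)) yy' take_history ?(ltnW lt_in) // yi.
Qed.

Lemma measurable_bet lam p w (Q : seq A -> Prop) c j n : (j <= n)%N ->
  measurable [set t | Q (hist j t) /\ c <= capital lam p w x (trajectory X t) j n].
Proof.
move=> jn; apply: (measurable_past Xproc (n := n)) => t t' tt' [Qt ct]; split.
  by rewrite -(take_history _ jn) -tt' take_history.
by rewrite -(eq_capital _ _ _ _ tt').
Qed.

(** Ville's inequality for the capital, given the past u at the starting time.
    The induction is on the number m of remaining steps, for all thresholds c
    at once: a factor f gained in the first step divides the threshold for the
    other steps by f, and as the bet is fair the average of f is 1. *)
Lemma ville lam w : `|lam| <= 2^-1 -> memory_word P X w ->
  forall m u c, 0 < c ->
  fine (P [set t | hist (size u) t = u /\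
                   c <= bet lam w (trajectory X t) (size u) (size u + m)])
    <= cyl u / c.
Proof.
move=> lam_small mw; set p := next_prob P X x w.
have p0 : 0 <= p by apply: next_prob_ge0.
have p1 : p <= 1 by apply: next_prob_le1.
have mbet v c j n : (j <= n)%N ->
    measurable [set t | hist j t = v /\ c <= bet lam w (trajectory X t) j n].
  exact: (measurable_bet lam p w (fun h => h = v)).
elim=> [|m IHm] u c c_gt0.
  rewrite addn0; have [c1|c1] := leP c 1.
    apply: (@le_trans _ _ (cyl u)).
      apply: le_fine_prob; first exact: mbet.
        exact: measurable_cylinder.
      by move=> t [].
    by rewrite ler_pdivlMr // ler_piMr ?cylinder_prob_ge0.
  rewrite (_ : [set t | _] = set0) ?measure0 ?divr_ge0 ?cylinder_prob_ge0 ?ltW //.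
  apply/seteqP; split=> // t [_]; rewrite /capital big_geq //.
  by rewrite leNgt c1.
set s := suffix w u.
pose f (b : bool) := 1 + lam * s%:R * (b%:R - p).
have f_gt0 b : 0 < f b.
  rewrite /f; move: lam_small; rewrite ler_norml => /andP[l1 l2].
  by clear f; case: s; case: b; rewrite /= ?mulr1n ?mulr0n; nra.
set E := [set t | _].
have mE : measurable E by apply: mbet; rewrite leq_addr.
have mX a : measurable (X (size u)%:Z @^-1` [set a]) by exact: Xproc.
have le_a a : fine (P (E `&` X (size u)%:Z @^-1` [set a])) <=
    f (a == x) / c * cyl (rcons u a).
  have c'_gt0 : 0 < c / f (a == x) by rewrite divr_gt0.
  have := IHm (rcons u a) _ c'_gt0; rewrite invf_div => le_rcons.
  rewrite [leRHS]mulrC; apply: le_trans le_rcons.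
  apply: le_fine_prob; first exact: measurableI.
    by apply: mbet; rewrite leq_addr.
  move=> t [[tu ct] /= ta]; split.
    by rewrite size_rcons historyS tu {1}/trajectory ta.
  rewrite size_rcons ler_pdivrMr // mulrC; apply: le_trans ct _.
  rewrite addSnnS /capital big_ltn ?addnS ?ltnS ?leq_addr //.
  by rewrite /trajectory /= ta tu.
(* The factor f only depends on whether the next letter is x, so the other
   letters are treated together. *)
have fineE : fine (P E) <= f true / c * cyl (rcons u x) +
    f false / c * (cyl u - cyl (rcons u x)).
  rewrite (fine_prob_split P mE (mX x)); apply: lerD.
    by have := le_a x; rewrite eqxx.
  have mU := measurable_cylinder Xproc u.
  have -> : cyl u - cyl (rcons u x) = fine (P ([set t | hist (size u) t = u] `\`
      X (size u)%:Z @^-1` [set x])).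
    rewrite /cylinder_prob (fine_prob_split P mU (mX x)) cylinder_rcons.
    by rewrite addrAC subrr add0r.
  apply: (countable_domination (f := X (size u)%:Z)) => // [|||a].
  - by rewrite divr_ge0 // ltW.
  - exact: measurableD.
  - exact: measurableD.
  have [->|ax] := eqVneq a x.
    by rewrite !setDE -!setIA setICl !setI0 measure0 mulr0.
  have DX (G : set T) : (G `\` X (size u)%:Z @^-1` [set x]) `&`
      X (size u)%:Z @^-1` [set a] = G `&` X (size u)%:Z @^-1` [set a].
    apply/seteqP; split=> t /= [Gt Xt]; split=> //; first by case: Gt.
    by split=> // Xx; move/eqP: ax; apply; rewrite -Xt.
  rewrite !DX -cylinder_rcons; have := le_a a.
  by rewrite (negbTE ax).
apply: (le_trans fineE).
rewrite le_eqVlt; apply/orP; left; apply/eqP.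
have [su|su] := boolP s; last by rewrite /f (negbTE su) mulr0n mulr0 !mul0r addr0; ring.
rewrite (cylinder_prob_rcons_memory mw su) -/p /f su /= mulr1n mulr0n; ring.
Qed.

(** The bet on the word that consists of the last k letters before time j: this
    word is random, but it is known when the bets start. *)
Definition winning_bet lam c (n j k : nat) : set T :=
  [set t | let w := drop (j - k) (hist j t) in
    memory_word P X w /\ c <= bet lam w (trajectory X t) j n].

Lemma measurable_winning_bet lam c n j k : (j <= n)%N ->
  measurable (winning_bet lam c n j k).
Proof.
move=> jn; apply: (measurable_past Xproc (n := n)) => t t' tt'.
have jj' : hist j t = hist j t'.
  by rewrite -(take_history _ jn) tt' take_history.
by rewrite /winning_bet /= jj' (eq_capital _ _ _ _ tt').
Qed.

Lemma winning_bet_prob lam c n j k : `|lam| <= 2^-1 -> 0 < c -> (j <= n)%N ->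
  fine (P (winning_bet lam c n j k)) <= c^-1.
Proof.
move=> lam_small c_gt0 jn.
have mj u : measurable ((fun t => hist j t) @^-1` [set u]).
  by apply: (measurable_past Xproc (n := j)) => t t' /= ->.
have mw := measurable_winning_bet lam c k jn.
have -> : c^-1 = c^-1 * fine (P setT) by rewrite probability_setT mulr1.
apply: (countable_domination (f := fun t => hist j t)) => // [|u].
  by rewrite invr_ge0 ltW.
rewrite setTI; set w := drop (j - k) u.
have [[ju mu]|no] := pselect (size u = j /\ memory_word P X w); last first.
  rewrite (_ : _ `&` _ = set0).
    by rewrite measure0 mulr_ge0 ?invr_ge0 ?(ltW c_gt0) ?fine_ge0.
  apply/seteqP; split=> // t [[mu _] /= tu]; apply: no; split.
    by rewrite -tu size_history.
  by rewrite /w -tu.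
have -> : fine (P ((fun t => hist j t) @^-1` [set u])) = cyl u.
  by rewrite /cylinder_prob ju.
rewrite mulrC; have := ville lam_small mu (n - j) u c_gt0.
rewrite ju subnKC // => le_ville; apply: le_trans le_ville.
apply: le_fine_prob; first exact: measurableI.
  exact: (measurable_bet _ _ _ (fun h => h = u)).
by move=> t [[_ ct] /= tu]; rewrite tu in ct.
Qed.

(** There are (n+2)^2 pairs (j, k), so the threshold (n+2)^4 leaves a summable
    bound (n+2)^-2. *)
Lemma eventually_no_winning_bet lam : `|lam| <= 2^-1 ->
  {ae P, forall t, \forall n \near \oo, forall j k,
    (j <= n.+1)%N -> (k <= n.+1)%N ->
    ~ winning_bet lam (n.+2%:R ^+ 4) n.+1 j k t}.
Proof.
move=> lam_small.
pose E n := \bigcup_(j in `I_n.+2) \bigcup_(k in `I_n.+2)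
  winning_bet lam (n.+2%:R ^+ 4) n.+1 j k.
have mwb n j k : (j < n.+2)%N ->
    measurable (winning_bet lam (n.+2%:R ^+ 4) n.+1 j k).
  by move=> jn; apply: measurable_winning_bet.
have mE1 n j : (j < n.+2)%N -> measurable (\bigcup_(k in `I_n.+2)
    winning_bet lam (n.+2%:R ^+ 4) n.+1 j k).
  by move=> jn; apply: bigcup_measurable => k _; exact: mwb.
have mE n : measurable (E n) by apply: bigcup_measurable => j; exact: mE1.
have leE n : fine (P (E n)) <= (n.+1%:R * n.+2%:R)^-1.
  apply: (@le_trans _ _ (n.+2%:R * (n.+2%:R * (n.+2%:R ^+ 4)^-1))).
    apply: fine_prob_bigcup_le => j jn; first exact: mE1.
    apply: fine_prob_bigcup_le => k _; first exact: mwb.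
    by apply: winning_bet_prob => //; rewrite exprn_gt0.
  have := ltr0Sn R n; have := ltr0Sn R n.+1; rewrite -[n.+2%:R]natr1.
  move: (n.+1%:R : R) => a a1 a0.
  rewrite (_ : _ * _ = ((a + 1) * (a + 1))^-1); last by field; rewrite gt_eqF.
  by rewrite lef_pV2 ?posrE ?mulr_gt0 // ler_wpM2r ?lerDl ?ltW.
apply: filterS (borel_cantelli mE leE) => t; apply: filterS => n nE j k jn kn wb.
by apply: nE; exists j => //; exists k.
Qed.

End Gambling.

(** * Counting visits to a word *)

Section Counting.
Context (R : realType) (A : countType) (x : A) (y : int -> A).
Implicit Types (w : seq A) (j k n : nat) (lam p M : R).

Definition visits w j n : nat := (\sum_(j <= i < n) suffix w (history y i))%N.

Definition successes w j n : nat :=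
  (\sum_(j <= i < n) (suffix w (history y i) && (y i%:Z == x)))%N.

Lemma suffix_history w k n : size w = k -> (k <= n)%N ->
  suffix w (history y n) = (drop (n - k) (history y n) == w).
Proof. by move=> wk kn; rewrite suffixE size_history wk. Qed.

Lemma last_wordE k n : (k <= n.+1)%N ->
  str y (n%:Z - k%:Z + 1) n%:Z = drop (n.+1 - k) (history y n.+1).
Proof.
move=> kn; rewrite -drop_history // -(addn1 n) PoszD addrK.
by congr (str y _ _); ring.
Qed.

Lemma qhatE k n : (k <= n.+1)%N ->
  let w := drop (n.+1 - k) (history y n.+1) in
  qhat R y n k x = (successes w k n.+1)%:R / (visits w k n.+1)%:R.
Proof.
move=> kn w; have wk : size w = k by rewrite size_drop size_history subKn.
have matchE j : (k <= j < n.+1)%N -> suffix w (history y j) =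
    (str y (j%:Z - k%:Z) (j%:Z - 1) == str y (n%:Z - k%:Z + 1) n%:Z).
  by case/andP=> kj _; rewrite (suffix_history wk kj) drop_history // last_wordE.
rewrite /qhat /successes /visits; congr (_%:R / _%:R).
  by apply: eq_big_nat => j /matchE ->.
by apply: eq_big_nat => j /matchE ->.
Qed.

(** An occurrence that starts at position i is a visit at time i + |w|; starting
    positions that leave too few letters give no occurrence. *)
Lemma occurrencesE w n : (size w <= n)%N ->
  occurrences w (history y n) = visits w (size w) n.+1.
Proof.
move=> wn; rewrite /occurrences /visits size_history -sum1_count big_mkcond.
rewrite -{1}[size w]add0n big_addn.
rewrite -[iota 0 n.+1]/(index_iota 0 n.+1).
rewrite (@big_cat_nat _ _ _ (n.+1 - size w)) ?leq_subr //=.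
rewrite [X in (_ + X)%N]big_nat_cond [X in (_ + X)%N]big1 ?addn0; last first.
  move=> i /andP[/andP[ni i_n] _]; case: ifP => // /size_prefix.
  rewrite size_drop size_history leq_subRL // => le_w.
  by move: ni; rewrite leq_subLR addnC ltnNge le_w.
apply: eq_big_nat => i /andP[_ ni].
have iw_n : (i + size w <= n)%N by rewrite addnC -leq_subRL // -ltnS -subSn.
rewrite (suffix_history (erefl _)) ?leq_addl // addnK prefixE take_drop addnC.
by rewrite take_history //; case: eqP.
Qed.

(** The occurrence at the very end of the past is not followed by a known
    letter, and the estimate does not count it. *)
Lemma occurrences_visits k n : (k <= n.+1)%N ->
  let w := drop (n.+1 - k) (history y n.+1) in
  occurrences w (history y n.+1) = (visits w k n.+1).+1.
Proof.
move=> kn w; have wk : size w = k by rewrite size_drop size_history subKn.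
rewrite occurrencesE wk // /visits big_nat_recr //= (suffix_history wk kn) eqxx.
by rewrite addn1.
Qed.

(** If the bets start at the first visit to w, then they see all the visits. *)
Lemma first_visit k n : (k <= n.+1)%N ->
  let w := drop (n.+1 - k) (history y n.+1) in
  exists j, [/\ (k <= j <= n.+1)%N, drop (j - k) (history y j) = w,
    visits w k n.+1 = visits w j n.+1 &
    successes w k n.+1 = successes w j n.+1].
Proof.
move=> kn w; have wk : size w = k by rewrite size_drop size_history subKn.
have ex_j : exists j, suffix w (history y j) by exists n.+1; exact: suffix_drop.
case: (ex_minnP ex_j) => j wj minj; exists j.
have kj : (k <= j)%N by have := size_suffix wj; rewrite size_history wk.
have jn : (j <= n.+1)%N by apply: minj; exact: suffix_drop.
have before i : (k <= i < j)%N -> suffix w (history y i) = false.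
  by case/andP=> _ ij; apply/negP => /minj; rewrite leqNgt ij.
split; first by rewrite kj.
- by apply/eqP; rewrite -(suffix_history wk kj).
- rewrite /visits (big_cat_nat kj jn) /= big_nat big1 ?add0n // => i.
  by move=> /before ->.
- rewrite /successes (big_cat_nat kj jn) /= big_nat big1 ?add0n // => i.
  by move=> /before ->.
Qed.

(** Apply 1 + u <= exp u to u = - (v - 2 v^2) and use
    (1 + v) (1 - v + 2 v^2) = 1 + v^2 (1 + 2 v) >= 1. *)
Lemma expR_le1D v : - 2^-1 <= v -> expR (v - 2 * v ^+ 2) <= 1 + v :> R.
Proof.
move=> v_ge; have D_gt0 : 0 < 1 - v + 2 * v ^+ 2 by nra.
have := expR_ge1Dx (- (v - 2 * v ^+ 2)); rewrite expRN => le_inv.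
have e_gt0 := expR_gt0 (v - 2 * v ^+ 2).
have le1 : expR (v - 2 * v ^+ 2) * (1 - v + 2 * v ^+ 2) <= 1.
  rewrite -[leRHS](divff (lt0r_neq0 e_gt0)) ler_pM2l //.
  by apply: le_trans le_inv; lra.
rewrite -(ler_pM2r D_gt0); apply: le_trans le1 _.
nra.
Qed.

(** Each visit multiplies the capital by 1 + lam (b - p), with b = 1 for a
    success and b = 0 otherwise, and [expR_le1D] applies to each factor. *)
Lemma capital_ge lam p w j n : `|lam| <= 2^-1 -> 0 <= p <= 1 ->
  expR (lam * ((successes w j n)%:R - p * (visits w j n)%:R)
        - 2 * lam ^+ 2 * (visits w j n)%:R) <= capital lam p w x y j n.
Proof.
rewrite ler_norml => /andP[l1 l2] /andP[p0 p1].
have -> : lam * ((successes w j n)%:R - p * (visits w j n)%:R)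
    - 2 * lam ^+ 2 * (visits w j n)%:R =
    \sum_(j <= i < n) (lam * ((suffix w (history y i) && (y i%:Z == x))%:R
      - p * (suffix w (history y i))%:R)
      - 2 * lam ^+ 2 * (suffix w (history y i))%:R).
  by rewrite sumrB -!mulr_sumr sumrB -!mulr_sumr /successes /visits !natr_sum.
rewrite expR_sum; apply: ler_prod => i _; rewrite expR_ge0 /=.
case: (suffix w _) => /=; last by rewrite !mulr0 subrr mulr0 !mul0r subrr expR0 addr0.
set b := (y i%:Z == x)%:R : R; rewrite !mulr1.
have [b0 b1] : 0 <= b /\ b <= 1 by rewrite /b; case: (_ == _).
have v_ge : - 2^-1 <= lam * (b - p) by nra.
apply: le_trans (expR_le1D v_ge); rewrite ler_expR lerD2l lerN2.
rewrite ler_pM2l // exprMn ler_piMr ?sqr_ge0 //; nra.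
Qed.

(** The bet on x bounds the frequency from above, the bet against x bounds it
    from below. *)
Lemma frequency_bound lam p M w j n : 0 < lam <= 2^-1 -> 0 <= p <= 1 ->
  (0 < visits w j n)%N ->
  capital lam p w x y j n < M -> capital (- lam) p w x y j n < M ->
  `|(successes w j n)%:R / (visits w j n)%:R - p| <=
    2 * lam + ln M / (lam * (visits w j n)%:R).
Proof.
move=> /andP[l0 l1] p01 D_gt0 capM capN.
have l_small : `|lam| <= 2^-1 by rewrite gtr0_norm.
have lN_small : `|- lam| <= 2^-1 by rewrite normrN.
have := le_lt_trans (capital_ge w j n l_small p01) capM.
have := le_lt_trans (capital_ge w j n lN_small p01) capN.
have D0 : 0 < (visits w j n)%:R :> R by rewrite ltr0n.
move: D0; set D : R := (visits w j n)%:R; set C : R := (successes w j n)%:R.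
move=> D0 e1 e2.
have M0 : 0 < M := lt_trans (expR_gt0 _) e1.
move: e1 e2; rewrite -{1 2}(lnK (x := M)) ?posrE // !ltr_expR => e1 e2.
have -> : C / D - p = (lam * (C - p * D)) / (lam * D).
  by field; rewrite !gt_eqF.
have -> : 2 * lam + ln M / (lam * D) = (2 * lam ^+ 2 * D + ln M) / (lam * D).
  by field; rewrite !gt_eqF.
have lD : 0 < lam * D by rewrite mulr_gt0.
rewrite normrM normfV (gtr0_norm lD) ler_pM2r ?invr_gt0 // ler_norml.
by apply/andP; split; nra.
Qed.

End Counting.

(** With z = n^(a/2), the logarithm is at most a constant times z, since
    ln u < u for u = (n+2)^(a/2); and n^a = z^2. *)
Lemma powR_dominates_ln (R : realType) (K a : R) : 0 <= K -> 0 < a ->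
  \forall n \near \oo, K * ln (n.+2%:R ^+ 4) + 1 <= (n%:R : R) `^ a.
Proof.
move=> K0 a0; have b0 : 0 < a / 2 by rewrite divr_gt0.
pose K' := K * (4 * ((a / 2)^-1 * 3 `^ (a / 2))).
have K'0 : 0 <= K' by rewrite !mulr_ge0 // ?invr_ge0 ?powR_ge0 ?ltW.
near=> n.
have n1 : (0 < n)%N by near: n; exact: nbhs_infty_gt.
set z : R := n%:R `^ (a / 2).
have zK : K' + 1 <= z.
  have nB : (K' + 1) `^ (a / 2)^-1 <= n%:R by near: n; exact: nbhs_infty_ger.
  have := ge0_ler_powR (ltW b0) _ _ nB; rewrite !nnegrE powR_ge0 ler0n.
  rewrite -powRrM mulVf ?gt_eqF // powRr1 ?addr_ge0 //; exact.
have le_ln : ln (n.+2%:R : R) <= (a / 2)^-1 * 3 `^ (a / 2) * z.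
  have n2 : 0 < n.+2%:R :> R by rewrite ltr0n.
  rewrite -mulrA mulrC ler_pdivlMr // mulrC -ln_powR.
  apply: (le_trans (ltW (ln_sublinear _))); first by rewrite powR_gt0.
  rewrite -powRM ?ler0n //; apply: ge0_ler_powR; first exact: ltW.
  - by rewrite nnegrE ler0n.
  - by rewrite nnegrE mulr_ge0 ?ler0n.
  - by rewrite -natrM ler_nat; lia.
have -> : (n%:R : R) `^ a = z * z.
  rewrite /z -powRD; last by rewrite pnatr_eq0 -lt0n n1 implybT.
  by rewrite -splitr.
rewrite lnXn ?ltr0n // -[ln _ *+ 4]mulr_natl.
have le_K : K * (4%:R * ln n.+2%:R) <= K' * z.
  rewrite /K' -[leRHS]mulrA ler_wpM2l // -[leRHS]mulrA.
  by rewrite ler_wpM2l // ler0n.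
apply: (@le_trans _ _ (K' * z + 1)); first by rewrite lerD2r.
nra.
Unshelve. all: by end_near. Qed.

(** * Convergence of the estimates *)

Section Convergence.
Context d (T : measurableType d) (R : realType) (P : probability T R).
Context (A : countType) (X : int -> T -> A).
Hypotheses (Xproc : is_process X) (Xstat : stationary P X).
Variable x : A.

Local Notation hist n t := (history (trajectory X t) n).

(** The words of length n are countably many, so the improbable ones have
    total probability zero. *)
Lemma ae_cylinder_prob_gt0 :
  {ae P, forall t, forall n, 0 < cylinder_prob P X (hist n t)}.
Proof.
apply: ae_foralln => n.
pose N := [set t | cylinder_prob P X (hist n t) = 0].
have mN : measurable N.
  by apply: (measurable_past Xproc (n := n)) => t t'; rewrite /N /= => ->.
have mn u : measurable ((fun t => hist n t) @^-1` [set u]).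
  by apply: (measurable_past Xproc (n := n)) => t t' /= ->.
exists N; split=> //.
  have : fine (P N) <= 0 * fine (P setT).
    apply: (countable_domination (f := fun t => hist n t)) => // u.
    rewrite mul0r; have [[un u0]|no] :=
      pselect (size u = n /\ cylinder_prob P X u = 0).
      rewrite -[leRHS]u0 /cylinder_prob un; apply: le_fine_prob.
      - exact: measurableI.
      - exact: mn.
      - by move=> t [].
    rewrite (_ : _ `&` _ = set0) ?measure0 //; apply/seteqP; split=> // t.
    case=> Nt /= tu; apply: no; split; first by rewrite -tu size_history.
    by rewrite -tu.
  rewrite mul0r => le0; rewrite -[LHS]/(P N) -(fine_probK P mN); congr EFin.
  by apply/eqP; rewrite eq_le le0 fine_ge0.
move=> t /= /negP; rewrite lt_neqAle cylinder_prob_ge0 andbT negbK eq_sym.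
by move/eqP.
Qed.

Lemma memory_word_at (n k : nat) (t : T) : memory P X n t = Some k ->
  memory_word P X (str (trajectory X t) (n%:Z - k%:Z + 1) n%:Z).
Proof.
rewrite /memory /memory_length; case: pselect => // ex_k [<-].
case: ex_minnP => j /asboolP + _; congr memory_word.
have := str_mkseq (shift_seq n%:Z (trajectory X t)) (1 - j%:Z) j.
rewrite subrK subrr => ->.
rewrite last_word_mkseq.
by apply: eq_mkseq => i; rewrite /shift_seq /trajectory; congr (X _ t); ring.
Qed.

Lemma next_given_past_memory (n k : nat) (t : T) : (k <= n.+1)%N ->
  let w := drop (n.+1 - k) (hist n.+1 t) in
  memory_word P X w -> 0 < cylinder_prob P X (hist n.+1 t) ->
  next_given_past P X n x t = next_prob P X x w.
Proof.
move=> kn w mw ht; rewrite next_given_pastE //.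
rewrite -[in LHS](cat_take_drop (n.+1 - k) (hist n.+1 t)) -/w.
by rewrite -memory_word_extend // cat_take_drop.
Qed.

Lemma occurrences_size (w u : seq A) :
  (0 < occurrences w u)%N -> (size w <= size u)%N.
Proof.
rewrite -has_count => /hasP[i _ /size_prefix]; rewrite size_drop => /leq_trans.
by apply; exact: leq_subr.
Qed.

Lemma qhat_deviation (lam M : R) (n k : nat) (t : T) : (k <= n.+1)%N ->
  let w := drop (n.+1 - k) (hist n.+1 t) in
  memory_word P X w -> 0 < lam <= 2^-1 ->
  (forall j, (j <= n.+1)%N -> ~ winning_bet P X x lam M n.+1 j k t) ->
  (forall j, (j <= n.+1)%N -> ~ winning_bet P X x (- lam) M n.+1 j k t) ->
  (1 < occurrences w (hist n.+1 t))%N ->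
  `|qhat R (trajectory X t) n k x - next_prob P X x w| <=
    2 * lam + ln M / (lam * ((occurrences w (hist n.+1 t))%:R - 1)).
Proof.
move=> kn w mw lam01 noM noN; rewrite occurrences_visits // -/w ltnS => D_gt0.
rewrite qhatE // -/w -[X in _ * (X - 1)]natr1 addrK.
have [j [/andP[kj jn] jw vj sj]] := first_visit x (trajectory X t) kn.
rewrite -/w in jw vj sj; rewrite vj sj in D_gt0 *.
apply: frequency_bound => //.
- by rewrite next_prob_ge0 ?next_prob_le1.
- rewrite ltNge; apply/negP => cap; apply: (noM j jn).
  by rewrite /winning_bet /= jw.
- rewrite ltNge; apply/negP => cap; apply: (noN j jn).
  by rewrite /winning_bet /= jw.
Qed.

End Convergence.

Theorem theorem8 (d : measure_display) (T : measurableType d) (R : realType)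
    (P : probability T R) (A : countType) (X : int -> T -> A)
    (Xproc : is_process X)
    (Xstat : stationary P X) (Xerg : ergodic P X)
    (Xfm : finitarily_markovian P X)
    (gamma : R) (gamma_gt0 : 0 < gamma) (gamma_lt1 : gamma < 1)
    (N : T -> set nat)
    (Nstop : forall n : nat, function_of_past X n (fun t => N t n))
    (Nfreq : {ae P, forall t, \forall n \near \oo, N t n ->
       exists2 k : nat, memory P X n t = Some k &
         (n%:R : R) `^ (1 - gamma) <=
         (occurrences (str (trajectory X t) (n%:Z - k%:Z + 1) n%:Z)
                      (str (trajectory X t) 0 n%:Z))%:R})
    (rho : nat -> T -> nat)
    (rho_past : forall n : nat, function_of_past X n (rho n))
    (rho_cvg : {ae P, forall t,
       (((rho n t)%:R)%:E - length_to_ereal R (memory P X n t))%E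
         @[n --> within (N t) \oo] --> 0%E})
    (x : A) :
  {ae P, forall t,
    `| qhat R (trajectory X t) n (rho n t) x - next_given_past P X n x t |
      @[n --> within (N t) \oo] --> (0 : R)}.
Proof.
have lam_small (l : nat) : 0 < (l.+2%:R^-1 : R) <= 2^-1.
  by rewrite invr_gt0 ltr0n /= lef_pV2 ?posrE ?ltr0n // ler_nat.
have norm_small (l : nat) : `|l.+2%:R^-1 : R| <= 2^-1.
  by have /andP[l0 l1] := lam_small l; rewrite gtr0_norm.
have normN_small (l : nat) : `|- (l.+2%:R^-1 : R)| <= 2^-1 by rewrite normrN.
have bets := ae_foralln (fun l =>
  eventually_no_winning_bet Xproc Xstat x (norm_small l)).
have betsN := ae_foralln (fun l =>
  eventually_no_winning_bet Xproc Xstat x (normN_small l)).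
have cyl_gt0 := ae_cylinder_prob_gt0 P Xproc.
apply: filterS3 Nfreq rho_cvg (filterI (filterI bets betsN) cyl_gt0).
move=> t freq cvg_rho [[bet_t betN_t] cyl_t].
apply/cvgrPdist_lt => e e_gt0; rewrite near_withinE.
have e4_gt0 : 0 < e / 4 by rewrite divr_gt0.
have [l l_small] : exists l : nat, (l.+2%:R^-1 : R) < e / 4.
  have [l _ /(_ l.+1 (leqnSn l))] := near_infty_natSinv_lt (PosNum e4_gt0).
  by exists l.
have /andP[lam_gt0 lam_le] := lam_small l.
move: l_small lam_gt0 lam_le (bet_t l) (betN_t l) => {bet_t betN_t}.
move: (l.+2%:R^-1 : R) => lam lam_small_e lam_gt0 lam_le bet_t betN_t.
have /fine_cvgP[_ /cvgrPdist_lt /(_ 1 ltr01)] := cvg_rho.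
rewrite near_withinE => near_rho.
have L_gt0 n : 0 < ln (n.+2%:R ^+ 4 : R).
  by rewrite ln_gt0 // exprn_egt1 // ltr1n.
have a_gt0 : 0 < 1 - gamma by rewrite subr_gt0.
(* This K makes ln c / (lam D) at most e / 4 as soon as K ln c <= D. *)
pose K := (lam * (e / 4))^-1.
have K_ge0 : 0 <= K by rewrite invr_ge0 mulr_ge0 ?ltW.
near=> n => Nn.
have n_gt0 : (0 < n)%N by near: n; exact: nbhs_infty_gt.
have [k memk freq_n] : exists2 k : nat, memory P X n t = Some k &
    (n%:R : R) `^ (1 - gamma) <=
    (occurrences (str (trajectory X t) (n%:Z - k%:Z + 1) n%:Z)
                 (str (trajectory X t) 0 n%:Z))%:R.
  by move: Nn; near: n.
have rho_k : rho n t = k.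
  have : `|0 - fine ((rho n t)%:R%:E - length_to_ereal R (memory P X n t))%E| < 1.
    by move: Nn; near: n.
  rewrite memk /= sub0r normrN ltr_norml => /andP[lo hi].
  apply/eqP; rewrite eqn_leq; apply/andP; split; rewrite -ltnS -(ltr_nat R);
    by rewrite -natr1; lra.
have noM : forall j k, (j <= n.+1)%N -> (k <= n.+1)%N ->
    ~ winning_bet P X x lam (n.+2%:R ^+ 4) n.+1 j k t by near: n.
have noN : forall j k, (j <= n.+1)%N -> (k <= n.+1)%N ->
    ~ winning_bet P X x (- lam) (n.+2%:R ^+ 4) n.+1 j k t by near: n.
have growth : K * ln (n.+2%:R ^+ 4) + 1 <= (n%:R : R) `^ (1 - gamma).
  by near: n; exact: powR_dominates_ln.
rewrite str_history in freq_n.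
(* A word longer than the past could not occur in it. *)
have kn : (k <= n.+1)%N.
  rewrite -[k](size_mkseq (fun i => trajectory X t (n%:Z - k%:Z + 1 + i%:Z))).
  rewrite -last_word_mkseq.
  rewrite -(size_history (trajectory X t) n.+1); apply: occurrences_size.
  by rewrite -(ltr_nat R); apply: lt_le_trans freq_n; rewrite powR_gt0 // ltr0n.
have mw := memory_word_at memk.
rewrite last_wordE // in mw freq_n.
have occ := le_trans growth freq_n.
rewrite (next_given_past_memory Xproc Xstat x kn mw (cyl_t n.+1)) rho_k.
rewrite sub0r normrN normr_id.
have occ_gt1 : (1 < occurrences (drop (n.+1 - k) (history (trajectory X t) n.+1))
    (history (trajectory X t) n.+1))%N.
  rewrite -(ltr_nat R); apply: lt_le_trans occ.
  by rewrite ltrDr mulr_gt0 // invr_gt0 mulr_gt0.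
have lam_range : 0 < lam <= 2^-1 by rewrite lam_gt0.
apply: le_lt_trans (qhat_deviation Xproc Xstat kn mw lam_range
  (fun j jn => noM j k jn kn) (fun j jn => noN j k jn kn) occ_gt1) _.
move: occ occ_gt1; rewrite -(ltr_nat R).
set m : R := (occurrences _ _)%:R => occ m_gt1.
have le_e : ln (n.+2%:R ^+ 4) / (lam * (m - 1)) <= e / 4.
  rewrite ler_pdivrMr ?mulr_gt0 ?subr_gt0 //.
  have -> : e / 4 * (lam * (m - 1)) = lam * (e / 4) * (m - 1) by ring.
  by rewrite -ler_pdivrMl ?mulr_gt0 // -/K lerBrDr.
lra.
Unshelve. all: by end_near. Qed.
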